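(* Consider the single stage pricing game with linear loyalty described in the context, with parameters $c_A\ge c_B\ge 0$, $l_\alpha,l_\beta>0$, $s_\alpha,s_\beta\ge 0$, $\theta\in(0,1)$, and $F$ the distribution function of the uniform distribution on $[0,1]$. Suppose (Region IV) $$c_A-c_B\le \min(s_\alpha-l_\alpha,\;l_\beta-s_\beta) .$$ Then the game has a unique pure Nash equilibrium, and its prices are $$p_A^\alpha=c_B+s_\alpha,\quad p_A^\beta=\tfrac13(c_B+2c_A-s_\beta+l_\beta),\quad p_B^\beta=\tfrac13(2c_B+c_A+s_\beta+2l_\beta),\quad p_B^\alpha=c_B .$$
   Context: Two firms $A$ and $B$ sell the same product, with unit product costs $c_A$ and $c_B$, where $c_A\ge c_B\ge 0$. Customers are partitioned into a set $\alpha$ (ex ante loyal to $A$; a fraction $\theta$ of the market; $A$'s strong and $B$'s weak sub-market) and a set $\beta$ (ex ante loyal to $B$; a fraction $1-\theta$; $B$'s strong and $A$'s weak sub-market). Both firms can tell the two sets apart. Each customer buys exactly one unit, from $A$ or from $B$. Firms move simultaneously: $A$ chooses $(p_A^\alpha,p_A^\beta)$ with $p_A^\alpha,p_A^\beta\ge c_A$, and $B$ chooses $(p_B^\beta,p_B^\alpha)$ with $p_B^\beta,p_B^\alpha\ge c_B$; the superscript is the set of customers to which the price is offered. Linear loyalty: a customer in $\alpha$ has loyalty level $l_\alpha\xi+s_\alpha$ and buys from $A$ iff $l_\alpha\xi+s_\alpha\ge p_A^\alpha-p_B^\alpha$; a customer in $\beta$ has loyalty level $l_\beta\xi+s_\beta$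 and buys from $B$ iff $l_\beta\xi+s_\beta\ge p_B^\beta-p_A^\beta$; here $\xi$ is random with distribution function $F$. Put $\xi^\alpha=(p_A^\alpha-p_B^\alpha-s_\alpha)/l_\alpha$ and $\xi^\beta=(p_B^\beta-p_A^\beta-s_\beta)/l_\beta$. For the uniform distribution, $F(x)=0$ for $x\le 0$, $F(x)=x$ for $0\le x\le1$, $F(x)=1$ for $x\ge1$. Profits: firm $A$ gets $(p_A^\alpha-c_A)\,\theta\,(1-F(\xi^\alpha))+(p_A^\beta-c_A)(1-\theta)F(\xi^\beta)$; firm $B$ gets $(p_B^\beta-c_B)(1-\theta)(1-F(\xi^\beta))+(p_B^\alpha-c_B)\,\theta\,F(\xi^\alpha)$. A pure Nash equilibrium is a price profile $(p_A^\alpha,p_A^\beta,p_B^\beta,p_B^\alpha)$ from which neither firm can strictly increase its profit by unilaterally changing its own (feasible) prices. *)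

(* Defs.v *)
From HB Require Import structures.
From mathcomp Require Import all_boot all_order all_algebra.
From mathcomp Require Import all_classical all_reals all_analysis.

Set Implicit Arguments.
Unset Strict Implicit.
Unset Printing Implicit Defensive.

Import Order.TTheory GRing.Theory Num.Theory.
Import numFieldNormedType.Exports.

Local Open Scope classical_set_scope.
Local Open Scope ring_scope.

(* [G_F] is the distribution function of the random variable xi that drives
   the loyalty levels [G_l_alpha * xi + G_s_alpha] and
   [G_l_beta * xi + G_s_beta].  The parameters are unconstrained here; the
   standing assumptions on them are hypotheses of the theorems. *)
Record pricing_game (R : realType) := PricingGame {
  G_c_A : R; G_c_B : R;
  G_theta : R;
  G_l_alpha : R; G_l_beta : R;
  G_s_alpha : R; G_s_beta : R;
  G_F : R -> R }.

Record strategyA (R : realType) := StrategyA { pA_alpha : R; pA_beta : R }.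

Record strategyB (R : realType) := StrategyB { pB_beta : R; pB_alpha : R }.

Section Game.
Context {R : realType} (G : pricing_game R).
Implicit Types (a : strategyA R) (b : strategyB R).

Definition feasibleA a : Prop :=
  G_c_A G <= pA_alpha a /\ G_c_A G <= pA_beta a.

Definition feasibleB b : Prop :=
  G_c_B G <= pB_beta b /\ G_c_B G <= pB_alpha b.

(* A customer of alpha buys from A iff xi >= xi_alpha, and one of beta buys
   from B iff xi >= xi_beta. *)
Definition xi_alpha a b : R :=
  (pA_alpha a - pB_alpha b - G_s_alpha G) / G_l_alpha G.

Definition xi_beta a b : R :=
  (pB_beta b - pA_beta a - G_s_beta G) / G_l_beta G.

Definition profitA a b : R :=
  (pA_alpha a - G_c_A G) * G_theta G * (1 - G_F G (xi_alpha a b)) +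
  (pA_beta a - G_c_A G) * (1 - G_theta G) * G_F G (xi_beta a b).

Definition profitB a b : R :=
  (pB_beta b - G_c_B G) * (1 - G_theta G) * (1 - G_F G (xi_beta a b)) +
  (pB_alpha b - G_c_B G) * G_theta G * G_F G (xi_alpha a b).

Definition pure_nash (s : strategyA R * strategyB R) : Prop :=
  [/\ feasibleA s.1, feasibleB s.2,
      (forall a, feasibleA a -> profitA a s.2 <= profitA s.1 s.2) &
      (forall b, feasibleB b -> profitB s.1 b <= profitB s.1 s.2)].

End Game.

(* [uniform_prob (@ltr01 R)] is the uniform law on [0, 1]. *)
Definition uniform01_cdf (R : realType) (x : R) : R :=
  fine (uniform_prob (@ltr01 R) `]-oo, x]).

Lemma uniform01_cdfE (R : realType) (x : R) :
  uniform01_cdf x = if x <= 0 then 0 else if x <= 1 then x else 1.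
Proof.
rewrite /uniform01_cdf /uniform_prob integral_uniform_pdf.
under eq_integral => y.
  rewrite inE/= => -[_ /=]; rewrite in_itv/= /uniform_pdf => ->.
  rewrite subr0 invr1; over.
rewrite /= integral_cst//=; last exact: measurableI.
rewrite mul1e.
have [x0|x0] := leP x 0.
  suff : (lebesgue_measure (`]-oo, x] `&` `[0%R, 1%R]) <= 0)%E.
    by rewrite measure_le0 => /eqP ->.
  rewrite -(lebesgue_measure_set1 0); apply: le_measure.
  - by rewrite inE; exact: measurableI.
  - by rewrite inE.
  - move=> y [/=]; rewrite !in_itv/= => yx /andP[y0 _].
    by apply/eqP; rewrite eq_le y0 (le_trans yx x0).
have [x1|x1] := leP x 1.
  rewrite (_ : _ `&` _ = `[0, x]%classic).
    by rewrite lebesgue_measure_itv/= lte_fin x0 oppr0 adde0.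
  apply/seteqP; split => y /=; rewrite !in_itv/=.
    by move=> [-> /andP[->]].
  by move=> /andP[y0 yx]; rewrite y0 yx (le_trans yx x1).
rewrite (_ : _ `&` _ = `[0%R, 1%R]%classic).
  by rewrite lebesgue_measure_itv/= lte_fin ltr01 oppr0 adde0.
apply/seteqP; split => y /=; rewrite !in_itv/=; first by case.
by move=> /andP[y0 y1]; rewrite y0 y1 (le_trans y1 (ltW x1)).
Qed.

(* Main.v *)
Require Import Defs.
From mathcomp Require Import all_boot all_order all_algebra.
From mathcomp Require Import all_classical all_reals all_analysis.
From mathcomp Require Import ring lra.

(* Profits are separable across the two sub-markets, so a profile is an
   equilibrium iff it is one in each sub-market.  In a single sub-market, let u
   and v be the margins of the strong and of the weak firm, and k the margin at
   which the strong firm just keeps every customer against v = 0.  The weak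
   firm's share times l is t = u - v - k clamped to [0, l].  In an interior
   equilibrium both firms equate their margin with their (scaled) sales, u = l - t
   and v = t, which forces k < l and the formulas for the contested market;
   t >= l never happens because the strong firm would win back customers; and
   t <= 0 forces v = 0, u = k and k >= l.  Region IV says that alpha has k >= l
   and beta has 0 <= k <= l. *)

Import Order.TTheory GRing.Theory Num.Theory.
Local Open Scope ring_scope.

Definition weak_share {R : realType} (l t : R) : R := uniform01_cdf (t / l).

(** Stated in margins over unit cost, so that feasibility is nonnegativity and both sub-markets are
    instances with the firms' roles exchanged. *)
Definition market_nash {R : realType} (k l u v : R) : Prop :=
  [/\ 0 <= u, 0 <= v,
      (forall u' : R, 0 <= u' ->
        u' * (1 - weak_share l (u' - v - k)) <=
        u * (1 - weak_share l (u - v - k))) &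
      (forall v' : R, 0 <= v' ->
        v' * weak_share l (u - v' - k) <= v * weak_share l (u - v - k))].

Section Market.
Set Implicit Arguments.
Unset Strict Implicit.
Context {R : realType} (k l : R).

Lemma weak_share_le0 (l0 : 0 < l) (t : R) : t <= 0 -> weak_share l t = 0.
Proof. by move=> t0; rewrite /weak_share uniform01_cdfE ler_pdivrMr// mul0r t0. Qed.

Lemma weak_share_mid (l0 : 0 < l) (t : R) : 0 <= t -> t <= l -> weak_share l t = t / l.
Proof.
move=> t0 tl; rewrite /weak_share uniform01_cdfE !ler_pdivrMr// mul0r mul1r tl.
by case: ifPn => // tle0; (have -> : t = 0 by lra); rewrite mul0r.
Qed.

Lemma weak_share_ge (l0 : 0 < l) (t : R) : l <= t -> weak_share l t = 1.
Proof.
move=> tl; rewrite /weak_share uniform01_cdfE !ler_pdivrMr// mul0r mul1r.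
rewrite leNgt (lt_le_trans l0 tl)/=; case: ifPn => // tlel.
by (have -> : t = l by lra); rewrite divff// gt_eqF.
Qed.

Lemma strong_profit_mid (l0 : 0 < l) (u t : R) : 0 <= t -> t <= l ->
  u * (1 - weak_share l t) = u * (l - t) / l.
Proof. by move=> t0 tl; rewrite (weak_share_mid l0)//; field; rewrite gt_eqF. Qed.

Lemma weak_profit_mid (l0 : 0 < l) (v t : R) : 0 <= t -> t <= l ->
  v * weak_share l t = v * t / l.
Proof. by move=> t0 tl; rewrite (weak_share_mid l0)// mulrA. Qed.

(* A firm that trades margin for sales one for one, at an interior point,
   moves from x part of the way towards y unless they are equal. *)
Lemma interior_margin_eq_sales (l0 : 0 < l) (x y : R) : 0 <= x -> 0 < y -> y < l ->
  (forall x' y' : R, 0 <= x' -> 0 <= y' -> y' <= l -> x' + y' = x + y ->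
     x' * y' <= x * y) -> x = y.
Proof.
move=> x0 y0 yl opt; apply/eqP/negPn/negP => xy.
(* This step keeps the new sales at most [l], because [y + r * x <= y + r * (x + l) = l]. *)
pose r := (l - y) / (x + l).
have xl0 : 0 < x + l by lra.
have r0 : 0 < r by rewrite divr_gt0//; lra.
have rE : r * (x + l) = l - y by rewrite /r divfK// gt_eqF.
have r1 : r < 1 by rewrite ltr_pdivrMr//; lra.
have := opt ((1 - r) * x + r * y) ((1 - r) * y + r * x).
have d0 : 0 < (x - y) ^+ 2.
  by rewrite lt_neqAle sqr_ge0 andbT eq_sym expf_eq0/= subr_eq0.
have g0 : 0 < r * (1 - r) * (x - y) ^+ 2.
  by apply: mulr_gt0 => //; apply: mulr_gt0 => //; rewrite subr_gt0.
have rx0 : 0 <= r * x by rewrite mulr_ge0// ltW.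
have ry0 : 0 <= r * y by rewrite mulr_ge0// ltW.
have sx0 : 0 <= (1 - r) * x by rewrite mulr_ge0//; lra.
have sy0 : 0 <= (1 - r) * y by rewrite mulr_ge0//; lra.
have rl0 : 0 <= r * l by rewrite mulr_ge0// ltW.
move=> /(_ ltac:(lra) ltac:(lra) ltac:(lra) ltac:(ring)).
have -> : ((1 - r) * x + r * y) * ((1 - r) * y + r * x) =
  x * y + r * (1 - r) * (x - y) ^+ 2 by ring.
lra.
Qed.

Lemma mulr_le_sqr_mid (x y z : R) : x + y = 2 * z -> x * y <= z * z.
Proof.
move=> xyz; have -> : y = 2 * z - x by lra.
have := sqr_ge0 (x - z); rewrite expr2; lra.
Qed.

Lemma market_nash_share_lt (l0 : 0 < l) (u v : R) :
  0 <= k -> market_nash k l u v -> u - v - k < l.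
Proof.
move=> k0 [u0 v0 optu _]; rewrite ltNge; apply/negP => tl.
(* A strong firm without customers earns nothing; this margin moves [t] to [l / 2] and earns a
   positive profit. *)
have /(_ ltac:(lra)) := optu (v + k + l / 2).
rewrite (weak_share_ge l0 tl) subrr mulr0.
rewrite (strong_profit_mid l0); [|lra|lra].
rewrite leNgt => /negP; apply.
by rewrite divr_gt0// mulr_gt0//; lra.
Qed.

Lemma market_nash_corner (l0 : 0 < l) (u v : R) : 0 <= k -> market_nash k l u v ->
  u - v - k <= 0 -> [/\ l <= k, u = k & v = 0].
Proof.
move=> k0 [u0 v0 optu optv] t0.
have uE : u = v + k.
  (* The largest margin that still keeps every customer. *)
  have /(_ ltac:(lra)) := optu (v + k).
  rewrite !(weak_share_le0 l0); lra.
have vE : v = 0.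
  apply/eqP/negPn/negP => vn0.
  have vgt0 : 0 < v by rewrite lt_neqAle eq_sym vn0.
  (* As [u = v + k], halving a positive [v] makes [t = v / 2 > 0], so the weak firm gains sales. *)
  have /(_ ltac:(lra)) := optv (v / 2).
  rewrite (weak_share_le0 l0 t0) mulr0 leNgt => /negP; apply.
  rewrite mulr_gt0//; first lra.
  have [tl|tl] := leP (u - v / 2 - k) l.
    by rewrite (weak_share_mid l0) ?divr_gt0//; lra.
  by rewrite (weak_share_ge l0) ?ltW.
split => //; last lra.
rewrite leNgt; apply/negP => kl.
(* This is [(k + l) / 2], the peak of the strong firm's interior profit [x * (l + k - x) / l]
   against [v = 0]. *)
have /(_ ltac:(lra)) := optu (k + (l - k) / 2).
rewrite (weak_share_le0 l0 t0) (strong_profit_mid l0); [|lra|lra].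
rewrite ler_pdivrMr// => h.
have : 0 < (l - k) * (l - k) by rewrite mulr_gt0//; lra.
rewrite uE vE in h; nra.
Qed.

(** Against a fixed rival, margin plus scaled sales is constant: [v + k + l] for the strong firm,
    [u - k] for the weak one. Hence [interior_margin_eq_sales] applies to both. *)
Lemma market_nash_interior (l0 : 0 < l) (u v : R) : market_nash k l u v ->
  0 < u - v - k -> u - v - k < l ->
  [/\ k < l, u = 3^-1 * (k + 2 * l) & v = 3^-1 * (l - k)].
Proof.
move=> [u0 v0 optu optv] t0 tl.
have ul : u = l - (u - v - k).
  apply: (interior_margin_eq_sales l0) => //; [lra|lra|move=> x' y' x0 y0 yl xy].
  have := optu x' x0.
  have -> : x' - v - k = l - y' by lra.
  rewrite !(strong_profit_mid l0); [|lra|lra|lra|lra].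
  by rewrite ler_pM2r ?invr_gt0// opprB addrCA subrr addr0.
have vl : v = u - v - k.
  apply: (interior_margin_eq_sales l0) => // x' y' x0 y0 yl xy.
  have := optv x' x0.
  have -> : u - x' - k = y' by lra.
  rewrite !(weak_profit_mid l0)//; [|lra|lra].
  by rewrite ler_pM2r ?invr_gt0.
split; lra.
Qed.

Lemma captive_market_nashP (l0 : 0 < l) (u v : R) : l <= k ->
  market_nash k l u v <-> u = k /\ v = 0.
Proof.
move=> lk; split=> [nash|[-> ->]].
  have k0 : 0 <= k by lra.
  have [t0|t0] := leP (u - v - k) 0.
    by have [] := market_nash_corner l0 k0 nash t0.
  have tl := market_nash_share_lt l0 k0 nash.
  have [] := market_nash_interior l0 nash t0 tl; lra.
split; [lra|by []|move=> u' u0|move=> v' v0].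
  rewrite (@weak_share_le0 l0 (k - 0 - k)); last lra.
  rewrite [1 - 0]subr0 mulr1.
  have [t0|t0] := leP (u' - 0 - k) 0; first by rewrite (weak_share_le0 l0)//; lra.
  have [tl|tl] := leP (u' - 0 - k) l; last first.
    by rewrite (weak_share_ge l0) ?(ltW tl)//; lra.
  (* The loss, scaled by [l], is [(u' - k) * (u' - l)], nonnegative since [l <= k < u']. *)
  rewrite (strong_profit_mid l0) ?(ltW t0)// ler_pdivrMr//; nra.
by rewrite mul0r (weak_share_le0 l0) ?mulr0//; lra.
Qed.

Lemma contested_market_nashP (l0 : 0 < l) (u v : R) : 0 <= k <= l ->
  market_nash k l u v <-> u = 3^-1 * (k + 2 * l) /\ v = 3^-1 * (l - k).
Proof.
move=> /andP[k0 kl]; split=> [nash|[uE vE]].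
  have [t0|t0] := leP (u - v - k) 0.
    (* The corner survives only at [k = l], where both formulas agree. *)
    have [] := market_nash_corner l0 k0 nash t0; split; lra.
  have tl := market_nash_share_lt l0 k0 nash.
  by have [] := market_nash_interior l0 nash t0 tl.
have tE : u - v - k = v by lra.
have v0 : 0 <= v by lra.
have u0 : 0 <= u by lra.
have lE : l = u + v by lra.
split=> // [u' u'0|v' v'0]; rewrite tE.
  rewrite (@strong_profit_mid l0 u v)//; last lra.
  have [t'0|t'0] := leP (u' - v - k) 0.
    rewrite (weak_share_le0 l0)// subr0 mulr1 ler_pdivlMr//.
    (* Taking the whole market needs [u' <= v + k = u - v], and [(u - v) * l = u ^+ 2 - v ^+ 2] by
       [l = u + v]. *)
    have : u' * l <= (u - v) * l by rewrite ler_pM2r//; lra.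
    have := sqr_ge0 v; rewrite expr2 lE; lra.
  have [t'l|t'l] := leP (u' - v - k) l; last first.
    by rewrite (weak_share_ge l0) ?(ltW t'l)// subrr mulr0 divr_ge0 ?mulr_ge0//; lra.
  rewrite (strong_profit_mid l0) ?(ltW t'0)// ler_pM2r ?invr_gt0//.
  by rewrite [X in _ <= _ * X](_ : _ = u); [apply: mulr_le_sqr_mid|]; lra.
rewrite (@weak_profit_mid l0 v v)//; last lra.
have [t'0|t'0] := leP (u - v' - k) 0.
  by rewrite (weak_share_le0 l0)// mulr0 divr_ge0 ?mulr_ge0//; lra.
have vt : v' * (u - v' - k) <= v * v by apply: mulr_le_sqr_mid; lra.
(* For positive [t], clamping can only lower the share, so the unclamped quadratic bounds the
   profit. *)
rewrite ler_pdivlMr//; apply: le_trans vt.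
rewrite -mulrA ler_wpM2l//.
have [t'l|t'l] := leP (u - v' - k) l.
  by rewrite (weak_share_mid l0) ?(ltW t'0)// divfK// gt_eqF.
by rewrite (weak_share_ge l0) ?(ltW t'l)// mul1r ltW.
Qed.

End Market.

(** Changing one price isolates one sub-market's term, whose positive weight cancels; conversely,
    the two inequalities for each firm add up. *)
Lemma pure_nash_marketP (R : realType)
    (c_A c_B theta l_alpha l_beta s_alpha s_beta : R)
    (htheta0 : 0 < theta) (htheta1 : theta < 1)
    (a : strategyA R) (b : strategyB R) :
  pure_nash (PricingGame c_A c_B theta l_alpha l_beta s_alpha s_beta
               (@uniform01_cdf R)) (a, b) <->
  market_nash (c_B + s_alpha - c_A) l_alpha
    (pA_alpha a - c_A) (pB_alpha b - c_B) /\
  market_nash (c_A + s_beta - c_B) l_beta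
    (pB_beta b - c_B) (pA_beta a - c_A).
Proof.
have th1 : 0 < 1 - theta by lra.
case: a => pa pb; case: b => qb qa.
have margins p q c d s : p - q - s = (p - c) - (q - d) - (d + s - c) :> R by ring.
rewrite /pure_nash /feasibleA /feasibleB /profitA /profitB /xi_alpha /xi_beta.
rewrite /market_nash /weak_share /=.
split=> [[[fpa fpb] [fqb fqa] optA optB]|
         [[fpa fqa optpa optqa] [fqb fpb optqb optpb]]].
  split; split; rewrite ?subr_ge0// => x x0.
  - have /(_ ltac:(split => /=; lra)) := optA (StrategyA (x + c_A) pb).
    rewrite /= lerD2r (margins (x + c_A) qa c_A c_B) (margins pa qa c_A c_B).
    by rewrite addrK !(mulrAC _ theta) ler_pM2r.
  - have /(_ ltac:(split => /=; lra)) := optB (StrategyB qb (x + c_B)).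
    rewrite /= lerD2l (margins pa (x + c_B) c_A c_B) (margins pa qa c_A c_B).
    by rewrite addrK !(mulrAC _ theta) ler_pM2r.
  - have /(_ ltac:(split => /=; lra)) := optB (StrategyB (x + c_B) qa).
    rewrite /= lerD2r (margins (x + c_B) pb c_B c_A) (margins qb pb c_B c_A).
    by rewrite addrK !(mulrAC _ (1 - theta)) ler_pM2r.
  - have /(_ ltac:(split => /=; lra)) := optA (StrategyA pa (x + c_A)).
    rewrite /= lerD2l (margins qb (x + c_A) c_B c_A) (margins qb pb c_B c_A).
    by rewrite addrK !(mulrAC _ (1 - theta)) ler_pM2r.
split; [split; lra|split; lra|move=> [x y]|move=> [y x]] => /= -[x0 y0].
- have /(_ ltac:(lra)) hx := optpa (x - c_A); have /(_ ltac:(lra)) hy := optpb (y - c_A).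
  rewrite (margins x qa c_A c_B) (margins pa qa c_A c_B).
  rewrite (margins qb y c_B c_A) (margins qb pb c_B c_A).
  by apply: lerD; rewrite ?(mulrAC _ theta) ?(mulrAC _ (1 - theta)) ler_pM2r.
- have /(_ ltac:(lra)) hx := optqa (x - c_B); have /(_ ltac:(lra)) hy := optqb (y - c_B).
  rewrite (margins pa x c_A c_B) (margins pa qa c_A c_B).
  rewrite (margins y pb c_B c_A) (margins qb pb c_B c_A).
  by apply: lerD; rewrite ?(mulrAC _ theta) ?(mulrAC _ (1 - theta)) ler_pM2r.
Qed.

Theorem proposition6 (R : realType)
    (c_A c_B theta l_alpha l_beta s_alpha s_beta : R)
    (hcB : 0 <= c_B) (hcAB : c_B <= c_A)
    (hla : 0 < l_alpha) (hlb : 0 < l_beta)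
    (hsa : 0 <= s_alpha) (hsb : 0 <= s_beta)
    (htheta0 : 0 < theta) (htheta1 : theta < 1)
    (hIV : c_A - c_B <= Num.min (s_alpha - l_alpha) (l_beta - s_beta)) :
  let G := PricingGame c_A c_B theta l_alpha l_beta s_alpha s_beta
             (@uniform01_cdf R) in
  (exists! s : strategyA R * strategyB R, pure_nash G s) /\
  (forall s : strategyA R * strategyB R, pure_nash G s ->
    [/\ pA_alpha s.1 = c_B + s_alpha,
        pA_beta s.1 = 3^-1 * (c_B + 2 * c_A - s_beta + l_beta),
        pB_beta s.2 = 3^-1 * (2 * c_B + c_A + s_beta + 2 * l_beta) &
        pB_alpha s.2 = c_B]).
Proof.
move=> G; move: hIV; rewrite le_min => /andP[captive contested].
have hk : l_alpha <= c_B + s_alpha - c_A by lra.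
(* The lower bound comes from [c_B <= c_A] and [0 <= s_beta], the upper one from Region IV. *)
have hk' : 0 <= c_A + s_beta - c_B <= l_beta by apply/andP; split; lra.
have prices s : pure_nash G s ->
    [/\ pA_alpha s.1 = c_B + s_alpha,
        pA_beta s.1 = 3^-1 * (c_B + 2 * c_A - s_beta + l_beta),
        pB_beta s.2 = 3^-1 * (2 * c_B + c_A + s_beta + 2 * l_beta) &
        pB_alpha s.2 = c_B].
  case: s => a b /pure_nash_marketP-/(_ htheta0 htheta1)[].
  move=> /(captive_market_nashP hla _ _ hk)[? ?].
  by move=> /(contested_market_nashP hlb _ _ hk')[? ?]; split => /=; lra.
split=> //.
exists (StrategyA (c_B + s_alpha) (3^-1 * (c_B + 2 * c_A - s_beta + l_beta)),
        StrategyB (3^-1 * (2 * c_B + c_A + s_beta + 2 * l_beta)) c_B).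
split.
  apply/pure_nash_marketP => //=; split.
    by apply/(captive_market_nashP hla _ _ hk); split; lra.
  by apply/(contested_market_nashP hlb _ _ hk'); split; lra.
by move=> [[pa pb] [qb qa]] /prices/=[-> -> -> ->].
Qed.
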